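(* Let $(\Omega_i,\mathcal{F}_i,p_i)_{i=1,\ldots,n}$ be a family of probability spaces, let $\Omega=\Omega_1\times\cdots\times\Omega_n$ be endowed with the product $\sigma$-algebra $\mathcal{F}$, let $\mathcal{M}:=\Pi(p_1,\ldots,p_n)$ be the set of multi-marginal couplings of $p_1,\ldots,p_n$, and let $p\in\mathcal{M}$ be concentrated on a marginal uniqueness set $S\in\mathcal{F}$ for $\Pi(p_1,\ldots,p_n)$. Then $p$ is $\ll$-minimal in $\mathcal{M}$. In particular, $p$ is an extreme point of $\mathcal{M}$, and $$\lim_{\lambda\uparrow1}\frac{D_\varphi(\lambda p+(1-\lambda)p'\,\|\,q)-D_\varphi(p\,\|\,q)}{1-\lambda}=-\infty$$ holds for every $p'\in\mathcal{M}\setminus\{p\}$, every $q\in\mathcal{M}$ with $p\ll q$ and $p'\ll q$, and every convex function $\varphi\colon[0,\infty)\to\mathbb{R}$ satisfying $$\varphi(1)=0,\quad\varphi'_+(0)=-\infty,\quad D_\varphi(p\,\|\,q)<\infty,\quad D_\varphi(p'\,\|\,q)<\infty.$$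
   Context: $\Pi(p_1,\ldots,p_n)$ is the set of all probability measures $p$ on $(\Omega,\mathcal{F})$ with $p\circ\operatorname{pr}_i^{-1}=p_i$ for all $i=1,\ldots,n$, where $\operatorname{pr}_i\colon\Omega\to\Omega_i$ is the $i$-th coordinate projection. A probability measure $p$ is concentrated on $S\in\mathcal{F}$ if $p(\Omega\setminus S)=0$. A set $S\in\mathcal{F}$ is a marginal uniqueness set for $\Pi(p_1,\ldots,p_n)$ if there is at most one element of $\Pi(p_1,\ldots,p_n)$ concentrated on $S$. We write $p\ll q$ for absolute continuity and $\frac{\mathrm{d}p}{\mathrm{d}q}\colon\Omega\to[0,\infty)$ for the Radon-Nikodym density. An element $p\in\mathcal{M}$ is $\ll$-minimal in $\mathcal{M}$ if there exists no $p'\in\mathcal{M}\setminus\{p\}$ with $p'\ll p$. An extreme point of a convex set $\mathcal{C}$ of probability measures is a $p\in\mathcal{C}$ such that $p=\lambda p'+(1-\lambda)p''$ with $p',p''\in\mathcal{C}$ and $\lambda\in(0,1)$ implies $p'=p''=p$. For a convex function $\varphi\colon[0,\infty)\to\mathbb{R}$ with $\varphi(1)=0$ and probability measures $p\ll q$ on $(\Omega,\mathcal{F})$, the $\varphi$-divergence of $p$ with respect to $q$ is $D_\varphi(p\,\|\,q):=\int_\Omega\varphi\big(\frac{\mathrm{d}p}{\mathrm{d}q}\big)\,\mathrm{d}q$. Moreover, $\varphi'_+(0):=\lim_{s\downarrow0}\frac{\varphi(s)-\varphi(0)}{s}\in[-\infty,\infty)$. *)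

(* Defs.v *)
From HB Require Import structures.
From mathcomp Require Import all_boot all_order all_algebra.
From mathcomp Require Import all_classical all_reals all_analysis.
From mathcomp Require Import giry.

Set Implicit Arguments.
Unset Strict Implicit.
Unset Printing Implicit Defensive.
Import Order.TTheory GRing.Theory Num.Theory.
Import numFieldNormedType.Exports.

Local Open Scope classical_set_scope.
Local Open Scope ring_scope.

Definition coordinate_cylinders n (d : 'I_n -> measure_display)
    (T : forall i, measurableType (d i)) : set (set (forall i, T i)) :=
  \bigcup_(i : 'I_n) preimage_set_system setT (fun w : forall j, T j => w i)
    measurable.
Arguments coordinate_cylinders {n d} T _.

Definition product_space n (d : 'I_n -> measure_display)
    (T : forall i, measurableType (d i)) :
    measurableType (coordinate_cylinders T).-sigma :=
  g_sigma_algebraType (coordinate_cylinders T).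

Definition pr n (d : 'I_n -> measure_display)
    (T : forall i, measurableType (d i)) (i : 'I_n) :
    product_space T -> T i := fun w => w i.
Arguments pr {n d T} i _.

(* The library's measures are functions on all sets, with unspecified values
   on the non-measurable ones; two of them are therefore identified as
   elements of a set of measures when they agree on measurable sets, which
   is what measure_eq says. *)

Definition couplings (R : realType) n (d : 'I_n -> measure_display)
    (T : forall i, measurableType (d i)) (P : forall i, probability (T i) R) :
    set (probability (product_space T) R) :=
  [set p | forall i (A : set (T i)), measurable A ->
     pushforward p (pr i) A = P i A].

Definition concentrated d (T : measurableType d) (R : realType)
    (p : probability T R) (S : set T) := p (~` S) = 0%E.

Definition marginal_uniqueness_set (R : realType) n
    (d : 'I_n -> measure_display) (T : forall i, measurableType (d i))
    (P : forall i, probability (T i) R) (S : set (product_space T)) :=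
  measurable S /\
  forall p p', couplings P p -> couplings P p' ->
    concentrated p S -> concentrated p' S -> measure_eq p p'.

Definition ll_minimal d (T : measurableType d) (R : realType)
    (M : set (probability T R)) (p : probability T R) :=
  M p /\ ~ exists p', [/\ M p', ~ (measure_eq p' p) & p' `<< p].

Definition extreme_point d (T : measurableType d) (R : realType)
    (C : set (probability T R)) (p : probability T R) :=
  C p /\ forall (p' p'' : probability T R) (l : R), C p' -> C p'' ->
    0 < l < 1 ->
    (forall A, measurable A -> p A = l%:E * p' A + (1 - l)%:E * p'' A)%E ->
    measure_eq p' p /\ measure_eq p'' p.

(* A charge, so as to be defined for every real l; it is a probability
   measure when 0 <= l <= 1. *)
Definition mixture d (T : measurableType d) (R : realType) (l : R)
    (p p' : probability T R) : {charge set T -> \bar R} :=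
  cadd (cscale l (charge_of_finite_measure p))
       (cscale (1 - l) (charge_of_finite_measure p')).

(* For a finite measure nu, 'd nu '/d q is only almost everywhere nonnegative;
   Num.max 0 turns it into a density with values in [0, +oo[, the domain
   of phi. The values of phi on ]-oo, 0[ play no role. *)
Definition phi_divergence d (T : measurableType d) (R : realType)
    (phi : R -> R) (nu : {charge set T -> \bar R}) (q : probability T R) :
    \bar R :=
  (\int[q]_x (phi (Num.max 0 (fine (Radon_Nikodym nu q x))))%:E)%E.

Definition convex_on_nonneg (R : realType) (phi : R -> R) :=
  convex_function (`[0, +oo[%classic : set R^o) (phi : R^o -> R^o).

(* Main.v *)
Require Import Defs.
From HB Require Import structures.
From mathcomp Require Import all_boot all_order all_algebra.
From mathcomp Require Import all_classical all_reals all_analysis.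
From mathcomp Require Import measurable_realfun giry.
From mathcomp Require Import ring lra.

(** If [p'] is a coupling with [p' `<< p], then [p'] does not charge [~` S]
    since [p] does not, so the marginal uniqueness of [S] forces [p' = p]. The
    components of a convex decomposition of [p] are dominated by [p], so [p] is
    also extreme.

    For the divergences, let [F] and [G] be the densities of [p] and [p'] with
    respect to [q]. As [p'] differs from [p], it charges [~` S], where [p]
    vanishes; hence [F = 0 < G] on a set of positive [q]-measure
    ([density_vanishing_set_neq0]), and even [F = 0] and
    [delta <= G <= K] on a set [A] of positive [q]-measure. Put [t = 1 - l].
    Off [A], convexity bounds the increment of [phi] between [F] and
    [(1 - t) F + t G] by [t (phi G - phi F)], hence by [t] times a fixed
    integrable function. On [A] the increment is [phi (t G) - phi 0], and the
    chord slopes of [phi] at [0] are nondecreasing, so it is at most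
    [t delta sl] as soon as [t K <= u] and the slope [sl] between [0] and [u]
    is nonpositive ([convex_mixture_le]). Integrating, the difference quotient
    of the divergence is at most [C + delta sl q(A)] for [l] close to [1], with
    [C] independent of [u]. By hypothesis [sl] is as negative as desired for a
    small [u], so the quotient tends to [-oo] ([divergence_slope_cvgNy]).

    The integrals are finite because a convex function vanishing at [1] is
    bounded below by an affine one ([convex_on_nonneg_lbound]), which is
    integrable along a density; only the upper bounds have to be assumed. *)

Import Order.TTheory GRing.Theory Num.Theory.
Import numFieldNormedType.Exports.
Local Open Scope classical_set_scope.
Local Open Scope ring_scope.

Set Implicit Arguments.
Unset Strict Implicit.
Unset Printing Implicit Defensive.

(** * Convex functions on the half-line *)

Section convex_on_nonneg.
Variables (R : realType) (phi : R -> R).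
Hypothesis phi_convex : convex_on_nonneg phi.

Lemma convex_on_nonneg_le (l x y : R) : 0 <= l <= 1 -> 0 <= x -> 0 <= y ->
  phi (l * x + (1 - l) * y) <= l * phi x + (1 - l) * phi y.
Proof.
move=> /andP[l0 l1] x0 y0.
have := @phi_convex (Itv01 l0 l1) x y; rewrite !convRE /=.
by apply; rewrite inE/= in_itv/= andbT.
Qed.

(** The chord slopes of [phi] at [0] are nondecreasing; the form multiplied by
    [s] makes sense for [s = 0] too. *)
Lemma convex_on_nonneg_slope (s u : R) : 0 <= s -> s <= u -> 0 < u ->
  phi s - phi 0 <= s * ((phi u - phi 0) / u).
Proof.
move=> s0 su u0.
have su1 : 0 <= s / u <= 1.
  by rewrite divr_ge0 ?(ltW u0)//= ler_pdivrMr// mul1r.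
have := convex_on_nonneg_le su1 (ltW u0) (lexx 0).
rewrite mulr0 addr0 divfK ?gt_eqF// => h.
have -> : s * ((phi u - phi 0) / u) = s / u * phi u - s / u * phi 0.
  by field; rewrite gt_eqF.
lra.
Qed.

(** As [1] lies between [0] and [t] when [t >= 1], and between [t] and [2] when
    [t <= 1], convexity and [phi 1 = 0] bound [phi t] from below by a multiple
    of [phi 0], respectively [phi 2]. This replaces a subgradient at [1]. *)
Lemma convex_on_nonneg_lbound (t : R) : phi 1 = 0 -> 0 <= t ->
  - ((`|phi 0| + `|phi 2|) * (1 + t)) <= phi t.
Proof.
move=> phi1 t0.
have a0 : - phi 0 <= `|phi 0| by rewrite -normrN ler_norm.
have a1 := ler_norm (phi 0).
have b1 := ler_norm (phi 2).
have A0 := normr_ge0 (phi 0).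
have B0 := normr_ge0 (phi 2).
have [t1|t1] := leP 1 t.
- have tp : 0 < t by lra.
  have ht : 0 <= t^-1 <= 1 by rewrite invr_ge0 t0/= invf_le1.
  have := convex_on_nonneg_le ht t0 (lexx 0).
  rewrite mulr0 addr0 mulVf ?gt_eqF// phi1 => h.
  have : 0 <= t * (t^-1 * phi t + (1 - t^-1) * phi 0) by rewrite mulr_ge0.
  have -> : t * (t^-1 * phi t + (1 - t^-1) * phi 0) = phi t + (t - 1) * phi 0.
    by field; rewrite gt_eqF.
  move=> h2; nra.
- have tp : 0 < 2 - t by lra.
  have ht : 0 <= (2 - t)^-1 <= 1 by rewrite invr_ge0 ltW//= invf_le1//; lra.
  have := convex_on_nonneg_le ht t0 (ler0n _ 2).
  have -> : (2 - t)^-1 * t + (1 - (2 - t)^-1) * 2 = 1.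
    by field; rewrite gt_eqF.
  rewrite phi1 => h.
  have : 0 <= (2 - t) * ((2 - t)^-1 * phi t + (1 - (2 - t)^-1) * phi 2).
    by rewrite mulr_ge0// ltW.
  have -> : (2 - t) * ((2 - t)^-1 * phi t + (1 - (2 - t)^-1) * phi 2)
    = phi t + (1 - t) * phi 2 by field; rewrite gt_eqF.
  move=> h2; nra.
Qed.

Lemma convex_on_nonneg_between (x y z : R) : 0 <= x -> x <= y -> y <= z ->
  phi y <= Num.max (phi x) (phi z).
Proof.
move=> x0 xy yz.
have [zx|zx] := eqVneq z x.
  have -> : y = x by apply/eqP; rewrite eq_le xy -zx yz.
  by rewrite le_max lexx.
have zx0 : 0 < z - x by rewrite subr_gt0 lt_neqAle eq_sym zx (le_trans xy).
have l01 : 0 <= (z - y) / (z - x) <= 1.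
  by rewrite divr_ge0 ?subr_ge0 ?(ltW zx0) ?(le_trans xy)//= ler_pdivrMr//; lra.
have z0 : 0 <= z by lra.
have := convex_on_nonneg_le l01 x0 z0.
have -> : (z - y) / (z - x) * x + (1 - (z - y) / (z - x)) * z = y.
  by field; rewrite gt_eqF.
have : phi x <= Num.max (phi x) (phi z) by rewrite le_max lexx.
have : phi z <= Num.max (phi x) (phi z) by rewrite le_max lexx orbT.
by move: l01 => /andP[]; nra.
Qed.

(** Convexity makes every sublevel set an interval. Continuity could not be
    used instead: [phi] may jump at [0]. *)
Lemma measurable_convex_on_nonneg :
  measurable_fun setT (fun y : R => phi (Num.max 0 y)).
Proof.
apply: (measurability _ (RGenInftyO.measurableE R)) => //.
move=> _ [_ [c ->] <-]; rewrite setTI.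
apply: is_interval_measurable => x z /=; rewrite !in_itv/= => px pz y.
move=> /andP[xy yz]; rewrite in_itv/=.
apply: (@le_lt_trans _ _ (Num.max (phi (Num.max 0 x)) (phi (Num.max 0 z)))).
  apply: convex_on_nonneg_between; first by rewrite le_max lexx.
    by rewrite ge_max !le_max lexx xy orbT.
  by rewrite ge_max !le_max lexx yz orbT.
by rewrite gt_max px pz.
Qed.

End convex_on_nonneg.

(** * Integrability from one-sided bounds *)

Section integrability.
Context d (T : measurableType d) (R : realType) (mu : {measure set T -> \bar R}).
Local Open Scope ereal_scope.

Lemma squeeze_integrable (f g h : T -> \bar R) : measurable_fun setT f ->
  mu.-integrable setT g -> mu.-integrable setT h ->
  (forall x, g x <= f x <= h x) -> mu.-integrable setT f.
Proof.
move=> mf ig ih gfh.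
apply: (@le_integrable _ _ _ mu setT measurableT f
  (fun x => `|g x| + `|h x|)) => //.
  move=> x _; have /andP[gf fh] := gfh x.
  rewrite [leRHS]gee0_abs ?adde_ge0 ?abse_ge0//.
  have [f0|f0] := leP 0 (f x).
    rewrite gee0_abs//; apply: (le_trans fh); apply: le_trans (lee_abs _) _.
    by rewrite leeDr// abse_ge0.
  rewrite lte0_abs//; apply: (@le_trans _ _ (- g x)); first by rewrite leeN2.
  apply: le_trans (lee_abs _) _; rewrite abseN leeDl// abse_ge0.
by apply: integrableD => //; exact: integrable_abse.
Qed.

Lemma integrable_lbound_lt_pinfty (f g : T -> \bar R) : measurable_fun setT f ->
  mu.-integrable setT g -> (forall x, g x <= f x) ->
  \int[mu]_x f x < +oo -> mu.-integrable setT f.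
Proof.
move=> mf ig gf foo.
have neg_fin : \int[mu]_x f^\- x < +oo.
  apply: le_lt_trans (integral_funeneg_lt_pinfty measurableT ig).
  apply: ge0_le_integral => //.
  - exact: measurable_funeneg.
  - by apply: measurable_funeneg; exact: measurable_int ig.
  - by move=> x _; apply: (@funeneg_le _ _ setT) => //; rewrite inE.
have neg_ge0 : 0 <= \int[mu]_x f^\- x by exact: integral_ge0.
have neg_fnum : \int[mu]_x f^\- x \is a fin_num by rewrite ge0_fin_numE.
apply/integrableP; split => //.
have -> : \int[mu]_x `|f x| = \int[mu]_x (f^\+ x + f^\- x).
  by apply: eq_integral => x _; rewrite -[LHS]/((abse \o f) x) fune_abse.
rewrite ge0_integralD//; [|exact: measurable_funepos|exact: measurable_funeneg].
rewrite lte_add_pinfty//.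
by move: foo; rewrite integralE lteBlDr// => /lt_le_trans; apply; rewrite leey.
Qed.

End integrability.

(** * Directional derivative of a convex integral functional *)

Section divergence_slope.
Context d (T : measurableType d) (R : realType) (q : probability T R).
Variable phi : R -> R.
Hypothesis phi_convex : convex_on_nonneg phi.
Hypothesis phi1 : phi 1 = 0.

(** A bound valid both on and off the set where [f = 0] and
    [delta <= g <= K], whose indicator is [b]. The absolute values keep the
    nonsingular term nonnegative, so that it needs no restriction to the
    complement of that set. *)
Lemma convex_mixture_le (b : bool) (f g t u delta K : R) :
  0 <= f -> 0 <= g -> 0 <= t <= 1 -> 0 < u -> t * K <= u ->
  (phi u - phi 0) / u <= 0 ->
  (b -> [/\ f = 0, delta <= g & g <= K]) ->
  phi ((1 - t) * f + t * g) <=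
    phi f + t * (`|phi f| + `|phi g| + delta * ((phi u - phi 0) / u) * b%:R).
Proof.
move=> f0 g0 /andP[t0 t1] u0 tKu sl0 bfg.
have af := ler_norm (- phi f); rewrite normrN in af.
have ag := ler_norm (phi g).
case: b bfg => [/(_ isT)[-> dg gK]|_]; last first.
  have h01 : 0 <= 1 - t <= 1 by rewrite subr_ge0 t1/= gerBl.
  have := convex_on_nonneg_le phi_convex h01 f0 g0.
  rewrite subKr mulr0 addr0 => h.
  by nra.
rewrite mulr0 add0r mulr1.
have tg0 : 0 <= t * g by rewrite mulr_ge0.
have tgu : t * g <= u by rewrite (le_trans _ tKu)// ler_wpM2l.
have := convex_on_nonneg_slope phi_convex tg0 tgu u0.
move: sl0; set sl := (phi u - phi 0) / u => sl0 h.
have := normr_ge0 (phi 0); have := normr_ge0 (phi g) => n1 n2.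
have : t * (g * sl) <= t * (delta * sl).
  by rewrite ler_wpM2l// ler_wnM2r.
nra.
Qed.

Lemma measurable_convex_comp (F : T -> R) : measurable_fun setT F ->
  (forall x, 0 <= F x) -> measurable_fun setT (fun x => phi (F x)).
Proof.
move=> mF F0.
have -> : (fun x => phi (F x)) = (fun y => phi (Num.max 0 y)) \o F.
  by apply/funext => x /=; rewrite (max_idPr (F0 x)).
exact: measurableT_comp (measurable_convex_on_nonneg phi_convex) mF.
Qed.

Lemma integrable_affine (F : T -> R) (c : R) :
  q.-integrable setT (EFin \o F) ->
  q.-integrable setT (EFin \o (fun x => c * (1 + F x))).
Proof.
move=> iF.
apply: (@eq_integrable _ _ _ _ _ measurableT
  (fun x => c%:E * ((EFin \o cst 1%R) \+ (EFin \o F)) x)%E) => //.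
apply: integrableZl => //; apply: integrableD => //.
exact: finite_measure_integrable_cst.
Qed.

Lemma integrable_convex_comp (F : T -> R) : (forall x, 0 <= F x) ->
  q.-integrable setT (EFin \o F) -> (\int[q]_x (phi (F x))%:E < +oo)%E ->
  q.-integrable setT (EFin \o (fun x => phi (F x))).
Proof.
move=> F0 iF phiF.
have mF : measurable_fun setT F by apply/measurable_EFinP; exact: measurable_int iF.
apply: (@integrable_lbound_lt_pinfty _ _ _ _ _
  (EFin \o (fun x => (- (`|phi 0| + `|phi 2|)) * (1 + F x)))) => //.
- by apply/measurable_EFinP; exact: measurable_convex_comp.
- exact: integrable_affine.
- by move=> x; rewrite lee_fin mulNr convex_on_nonneg_lbound.
Qed.

Variables F G : T -> R.
Hypothesis F_ge0 : forall x, 0 <= F x.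
Hypothesis G_ge0 : forall x, 0 <= G x.
Hypothesis F_integrable : q.-integrable setT (EFin \o F).
Hypothesis G_integrable : q.-integrable setT (EFin \o G).
Hypothesis phiF_lt_pinfty : (\int[q]_x (phi (F x))%:E < +oo)%E.
Hypothesis phiG_lt_pinfty : (\int[q]_x (phi (G x))%:E < +oo)%E.

Let mF : measurable_fun setT F.
Proof. by apply/measurable_EFinP; exact: measurable_int F_integrable. Qed.

Let mG : measurable_fun setT G.
Proof. by apply/measurable_EFinP; exact: measurable_int G_integrable. Qed.

(** On a slab, [1 - l] can be chosen uniformly in the point, which the set
    where [F = 0 < G] does not allow; the slabs exhaust that set. *)
Let vanishing_slab (n : nat) : set T :=
  [set x | F x = 0 /\ n.+1%:R^-1 <= G x <= n.+1%:R].

Let measurable_vanishing_slab n : measurable (vanishing_slab n).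
Proof.
rewrite (_ : vanishing_slab n =
    (F @^-1` [set 0]) `&` (G @^-1` `[n.+1%:R^-1, n.+1%:R]%classic)).
  by apply: measurableI; rewrite -[X in measurable X]setTI;
    [exact: mF|exact: mG].
by apply/seteqP; split => x /=; rewrite in_itv.
Qed.

Let exists_vanishing_slab : q [set x | F x = 0 /\ 0 < G x] != 0%E ->
  exists n, (0 < q (vanishing_slab n))%E.
Proof.
move=> q_neq0; apply: contrapT => /forallNP slab0.
have slab_negl n : q.-negligible (vanishing_slab n).
  apply/negligibleP => //; apply/eqP; rewrite eq_le measure_ge0 andbT leNgt.
  exact/negP/slab0.
have : q.-negligible [set x | F x = 0 /\ 0 < G x].
  apply: negligibleS (negligible_bigcup slab_negl) => x [Fx0 Gx0].
  pose n := maxn (Num.truncn (G x)) (Num.truncn (G x)^-1).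
  exists n => //; split => //.
  apply/andP; split.
    rewrite invf_ple ?posrE//; apply/ltW.
    apply: lt_le_trans (truncnS_gt _) _.
    by rewrite ler_nat ltnS leq_maxr.
  apply/ltW; apply: lt_le_trans (truncnS_gt _) _.
  by rewrite ler_nat ltnS leq_maxl.
move/negligibleP => h; move/eqP: q_neq0; apply; apply: h.
rewrite (_ : [set _ | _] = (F @^-1` [set 0]) `&` (G @^-1` `]0, +oo[%classic)).
  by apply: measurableI; rewrite -[X in measurable X]setTI;
    [exact: mF|exact: mG].
by apply/seteqP; split => x /=; rewrite in_itv/= andbT.
Qed.

(** Moving from [F] towards [G] makes [phi] drop infinitely fast at the points
    where [F] vanishes and [G] does not, whereas elsewhere the increments are
    at most linear in the step with an integrable factor. *)
Lemma divergence_slope_cvgNy :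
  q [set x | F x = 0 /\ 0 < G x] != 0%E ->
  ((phi s - phi 0) / s)%:E @[s --> 0^'+] --> -oo%E ->
  ((\int[q]_x (phi (l * F x + (1 - l) * G x))%:E - \int[q]_x (phi (F x))%:E)
     * ((1 - l)^-1)%:E)%E @[l --> 1^'-] --> -oo%E.
Proof.
move=> /exists_vanishing_slab[n qA0] slopeNy.
set A := vanishing_slab n in qA0; have mA : measurable A by exact: measurable_vanishing_slab.
have iphiF := integrable_convex_comp F_ge0 F_integrable phiF_lt_pinfty.
have iphiG := integrable_convex_comp G_ge0 G_integrable phiG_lt_pinfty.
pose V x := `|phi (F x)| + `|phi (G x)|.
have iV : q.-integrable setT (EFin \o V).
  apply: (@eq_integrable _ _ _ _ _ measurableT
    (fun x => `|(phi (F x))%:E| + `|(phi (G x))%:E|)%E) => //.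
  by apply: integrableD => //; exact: integrable_abse.
have iA : q.-integrable setT (EFin \o \1_A) by exact: integrable_indic.
have [C VC] : exists C : R, (\int[q]_x (V x)%:E = C%:E)%E.
  exists (fine (\int[q]_x (V x)%:E)%E).
  by rewrite fineK// (integrable_fin_num _ iV).
have [a qAa] : exists a : R, q A = a%:E.
  by exists (fine (q A)); rewrite fineK// fin_num_measure.
have IA : (\int[q]_x (\1_A x)%:E = a%:E)%E.
  by rewrite integral_indic// setIT; exact: qAa.
have [D phiFD] : exists D : R, (\int[q]_x (phi (F x))%:E = D%:E)%E.
  exists (fine (\int[q]_x (phi (F x))%:E)%E).
  by rewrite fineK// (integrable_fin_num _ iphiF).
have a0 : 0 < a by rewrite -lte_fin -qAa.
apply/cvgeNyPle => M.
pose delta : R := n.+1%:R^-1; pose K : R := n.+1%:R.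
have delta0 : 0 < delta by rewrite invr_gt0.
have K0 : 0 < K by [].
(* The second bound is what makes [C + delta * a * sl <= M] below. *)
have [u u0 slope_u] : exists2 u, 0 < u &
    (phi u - phi 0) / u <= Num.min 0 ((M - C) / (delta * a)).
  move: slopeNy => /cvgeNyPle/(_ (Num.min 0 ((M - C) / (delta * a)))) slope_near.
  have [u [u0 hu]] := filter_ex (filterI (nbhs_right_gt (0 : R)) slope_near).
  by exists u.
set sl := (phi u - phi 0) / u in slope_u.
have sl0 : sl <= 0 by move: slope_u; rewrite le_min => /andP[].
have slM : C + delta * a * sl <= M.
  move: slope_u; rewrite le_min => /andP[_].
  by rewrite ler_pdivlMr ?mulr_gt0// mulrC lerBrDl.
near=> l.
have l1 : l < 1 by near: l; exact: nbhs_left_lt.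
have l0 : 0 < l by near: l; apply: nbhs_left_gt.
(* It gives [t * K <= u]: on the slab, [t * G] stays below [u]. *)
have luK : 1 - u / K < l.
  by near: l; apply: nbhs_left_gt; rewrite gtrBl divr_gt0.
pose t := 1 - l; have t0 : 0 < t by rewrite subr_gt0.
have t1 : t <= 1 by rewrite gerBl ltW.
have tKu : t * K <= u.
  by rewrite -ler_pdivlMr// /t lerBlDr -lerBlDl ltW.
pose H x := l * F x + (1 - l) * G x.
pose U x := phi (F x) + t * (V x + delta * sl * \1_A x).
have HU x : phi (H x) <= U x.
  have -> : H x = (1 - t) * F x + t * G x by rewrite /H /t subKr.
  rewrite /U /V indicE.
  apply: (convex_mixture_le (F_ge0 x) (G_ge0 x) _ u0 tKu sl0).
    by rewrite (ltW t0) t1.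
  by rewrite inE => -[-> /andP[]].
have H_ge0 x : 0 <= H x by rewrite addr_ge0// mulr_ge0// ?ltW// subr_gt0.
have iH : q.-integrable setT (EFin \o H).
  apply: (@eq_integrable _ _ _ _ _ measurableT
    (fun x => l%:E * (F x)%:E + (1 - l)%:E * (G x)%:E)%E) => //.
  by apply: integrableD => //; exact: integrableZl.
have mH : measurable_fun setT H.
  by apply/measurable_EFinP; exact: measurable_int iH.
have iVA : q.-integrable setT (fun x => (V x)%:E + (delta * sl)%:E * (\1_A x)%:E)%E.
  by apply: integrableD => //; exact: integrableZl.
have iU : q.-integrable setT (EFin \o U).
  apply: (@eq_integrable _ _ _ _ _ measurableT
    (fun x => (phi (F x))%:E + t%:E * ((V x)%:E + (delta * sl)%:E * (\1_A x)%:E))%E) => //.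
  by apply: integrableD => //; exact: integrableZl.
have iphiH : q.-integrable setT (EFin \o (fun x => phi (H x))).
  apply: (@squeeze_integrable _ _ _ _ _
    (EFin \o (fun x => (- (`|phi 0| + `|phi 2|)) * (1 + H x))) _ _ _ iU).
  - by apply/measurable_EFinP; exact: measurable_convex_comp.
  - exact: integrable_affine.
  - by move=> x; rewrite !lee_fin mulNr convex_on_nonneg_lbound//= HU.
have UE : (\int[q]_x (U x)%:E = (D + t * (C + delta * sl * a))%:E)%E.
  rewrite (_ : \int[q]_x _ = \int[q]_x ((phi (F x))%:E +
      t%:E * ((V x)%:E + (delta * sl)%:E * (\1_A x)%:E)))%E; last first.
    by apply: eq_integral => x _; rewrite -!EFinM -!EFinD.
  rewrite integralD//; last exact: integrableZl.
  rewrite integralZl// integralD//; last exact: integrableZl.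
  rewrite integralZl//.
  by rewrite VC IA phiFD -!EFinM -!EFinD.
have HUint : (\int[q]_x (phi (H x))%:E <= (D + t * M)%:E)%E.
  apply: (@le_trans _ _ (\int[q]_x (U x)%:E)%E).
    by apply: le_integral => // x _; rewrite lee_fin.
  rewrite UE lee_fin lerD2l ler_wpM2l ?(ltW t0)//.
  by rewrite mulrAC.
rewrite phiFD lee_pdivrMr//.
rewrite leeBlDl// (le_trans HUint)// -EFinM -EFinD lee_fin.
by rewrite [M * _]mulrC.
Unshelve. all: by end_near.
Qed.

End divergence_slope.

(** * Densities with respect to a dominating probability *)

Section densities.
Context d (T : measurableType d) (R : realType).
Implicit Types (p q : probability T R) (nu : {charge set T -> \bar R}).

Definition density (nu : {charge set T -> \bar R}) q (x : T) : R :=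
  Num.max 0 (fine (Radon_Nikodym nu q x)).

Lemma density_ge0 nu q x : 0 <= density nu q x.
Proof. by rewrite le_max lexx. Qed.

Lemma measurable_density nu q : nu `<< q -> measurable_fun setT (density nu q).
Proof.
move=> nuq; apply: measurable_maxr => //.
exact: measurableT_comp (measurable_int _ (Radon_Nikodym_integrable nuq)).
Qed.

Lemma integrable_density nu q : nu `<< q ->
  q.-integrable setT (EFin \o density nu q).
Proof.
move=> nuq; apply: le_integrable (Radon_Nikodym_integrable nuq) => //.
  by apply/measurable_EFinP; exact: measurable_density.
move=> x _ /=; have := Radon_Nikodym_fin_num x nuq.
rewrite /density; case: (Radon_Nikodym nu q x) => [r| |]//= _.
rewrite lee_fin ger0_norm ?le_max ?lexx// ge_max normr_ge0/=.
exact: ler_norm.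
Qed.

Lemma ae_density p q : p `<< q ->
  ae_eq q setT (Radon_Nikodym (charge_of_finite_measure p) q)
    (EFin \o density (charge_of_finite_measure p) q).
Proof.
move=> pq.
have := ae_eq_Radon_Nikodym_SigmaFinite pq measurableT.
apply: filterS => x /(_ I) fE _.
have : (0 <= Radon_Nikodym (charge_of_finite_measure p) q x)%E.
  by rewrite -fE; exact: Radon_Nikodym_SigmaFinite.f_ge0.
have := @Radon_Nikodym_fin_num _ _ _ (charge_of_finite_measure p) q x pq.
rewrite /= /density; case: (Radon_Nikodym _ _ _) => [r| |]//= _.
by rewrite lee_fin => r0; rewrite (max_idPr r0).
Qed.

Lemma integral_density p q B : measurable B -> p `<< q ->
  p B = (\int[q]_(x in B) (density (charge_of_finite_measure p) q x)%:E)%E.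
Proof.
move=> mB pq; pose nu := charge_of_finite_measure p.
have nuq : nu `<< q by [].
apply: eq_trans (Radon_Nikodym_integral nuq mB) _.
apply: ae_eq_integral => //.
- apply: measurable_funTS.
  exact: measurable_int (Radon_Nikodym_integrable nuq).
- by apply: measurable_funTS; apply/measurable_EFinP; exact: measurable_density.
- by move: (ae_density pq); apply: filterS => x /(_ I) e _.
Qed.

(** The truncation at [0] in [density] is not additive in general; it commutes
    with the mixture because both densities are almost everywhere
    nonnegative. *)
Lemma ae_density_mixture (l : R) p p' q : 0 <= l <= 1 -> p `<< q -> p' `<< q ->
  ae_eq q setT (density (mixture l p p') q)
    (fun x => l * density (charge_of_finite_measure p) q x
      + (1 - l) * density (charge_of_finite_measure p') q x).
Proof.
move=> /andP[l0 l1] pq p'q.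
pose nu := charge_of_finite_measure p.
pose nu' := charge_of_finite_measure p'.
have nuq : nu `<< q by [].
have nu'q : nu' `<< q by [].
have lpq := dominates_cscalel l nuq.
have lp'q := dominates_cscalel (1 - l) nu'q.
have eD := Radon_Nikodym_cadd measurableT lpq lp'q.
have eZ := Radon_Nikodym_cscale l measurableT nuq.
have eZ' := Radon_Nikodym_cscale (1 - l) measurableT nu'q.
have eM : ae_eq q setT (Radon_Nikodym (mixture l p p') q)
    (fun x => l%:E * Radon_Nikodym nu q x
      + (1 - l)%:E * Radon_Nikodym nu' q x)%E.
  move: eD eZ eZ'; apply: filterS3 => x /(_ I) eD /(_ I) eZ /(_ I) eZ' _.
  by rewrite [LHS]eD /= eZ eZ'.
move: eM (ae_density pq) (ae_density p'q).
apply: filterS3 => x /(_ I) eM /(_ I) ep /(_ I) ep' _.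
rewrite {1}/density eM ep ep' -!EFinM -EFinD/=.
apply/max_idPr; rewrite addr_ge0// mulr_ge0// ?density_ge0//.
by rewrite subr_ge0.
Qed.

(** On a [p]-null set [B] the density of [p] vanishes almost everywhere. If
    that of [p'] vanished too wherever the density of [p] does, then
    integrating it over [B] would give [p' B = 0]. *)
Lemma density_vanishing_set_neq0 p p' q (B : set T) : measurable B ->
  p `<< q -> p' `<< q -> p B = 0%E -> p' B <> 0%E ->
  q [set x | density (charge_of_finite_measure p) q x = 0 /\
             0 < density (charge_of_finite_measure p') q x] != 0%E.
Proof.
move=> mB pq p'q pB p'B; apply/eqP => q0; apply: p'B.
set f := density _ _ in q0; set g := density (charge_of_finite_measure p') q in q0.
have mf : measurable_fun setT f by exact: measurable_density.
have mg : measurable_fun setT g by exact: measurable_density.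
have mfg : measurable [set x | f x = 0 /\ 0 < g x].
  rewrite (_ : [set _ | _] = (f @^-1` [set 0]) `&` (g @^-1` `]0, +oo[%classic)).
    by apply: measurableI; rewrite -[X in measurable X]setTI;
      [exact: mf|exact: mg].
  by apply/seteqP; split => x /=; rewrite in_itv/= andbT.
have f0 : ae_eq q B (EFin \o f) (cst 0%E).
  apply/ae_eq_integral_abs => //.
    by apply: measurable_funTS; exact/measurable_EFinP.
  rewrite -[RHS]pB (integral_density mB pq); apply: eq_integral => x _.
  by rewrite gee0_abs// lee_fin density_ge0.
rewrite (integral_density mB p'q) -[RHS](integral0 q B).
apply: ae_eq_integral => //.
  by apply: measurable_funTS; exact/measurable_EFinP.
have nfg : ae_eq q setT (fun x => `[< f x = 0 /\ 0 < g x >]) (cst false).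
  exists [set x | f x = 0 /\ 0 < g x]; split => // x /= fgx.
  by apply: contrapT => nfgx; apply: fgx => _; exact/asboolPn.
move: f0 nfg; apply: filterS2 => x f0 /(_ I)/asboolPn nfg Bx.
have [fx0] := f0 Bx.
congr EFin; apply/eqP; rewrite eq_le density_ge0 andbT leNgt; apply/negP => gx.
exact: nfg.
Qed.

End densities.

(** * Couplings concentrated on a marginal uniqueness set *)

Section concentration.
Context (R : realType) (n : nat) (d : 'I_n -> measure_display)
  (T : forall i : 'I_n, measurableType (d i))
  (P : forall i : 'I_n, probability (T i) R)
  (p : probability (product_space T) R) (S : set (product_space T)).
Hypotheses (p_coupling : couplings P p)
  (S_unique : marginal_uniqueness_set P S) (pS : concentrated p S).

Let mS : measurable S := S_unique.1.

Lemma coupling_concentrated_eq (p' : probability (product_space T) R) :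
  couplings P p' -> concentrated p' S -> measure_eq p' p.
Proof. by move=> cp' p'S; exact: S_unique.2. Qed.

Lemma marginal_uniqueness_ll_minimal : ll_minimal (couplings P) p.
Proof.
split=> // -[p' [cp' p'p /null_content_dominatesP p'_ll]].
apply/p'p/coupling_concentrated_eq => //.
by apply: p'_ll => //; exact: measurableC.
Qed.

Lemma marginal_uniqueness_extreme : extreme_point (couplings P) p.
Proof.
split=> // p' p'' l cp' cp'' /andP[l0 l1] pE.
have l1' : 0 < 1 - l by rewrite subr_gt0.
have := pE (~` S) (measurableC mS).
rewrite (pS : p (~` S) = 0%E) => /esym/eqP.
rewrite padde_eq0; last 2 first.
- by rewrite mule_ge0// lee_fin ltW.
- by rewrite mule_ge0// lee_fin ltW.
rewrite !mule_eq0 !eqe (gt_eqF l0) (gt_eqF l1')/= => /andP[/eqP p'S /eqP p''S].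
by split; exact: coupling_concentrated_eq.
Qed.

End concentration.

Unset Implicit Arguments.

Theorem proposition3p6 (R : realType) (n : nat) (d : 'I_n -> measure_display)
    (T : forall i : 'I_n, measurableType (d i))
    (P : forall i : 'I_n, probability (T i) R)
    (p : probability (product_space T) R) (S : set (product_space T)) :
  couplings P p ->
  marginal_uniqueness_set P S ->
  concentrated p S ->
  [/\ ll_minimal (couplings P) p,
      extreme_point (couplings P) p &
      forall (p' q : probability (product_space T) R) (phi : R -> R),
        couplings P p' -> ~ (measure_eq p' p) ->
        couplings P q -> p `<< q -> p' `<< q ->
        convex_on_nonneg phi ->
        phi 1 = 0 ->
        ((phi s - phi 0) / s)%:E @[s --> 0^'+] --> -oo%E ->
        (phi_divergence phi (charge_of_finite_measure p) q < +oo)%E ->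
        (phi_divergence phi (charge_of_finite_measure p') q < +oo)%E ->
        ((phi_divergence phi (mixture l p p') q
            - phi_divergence phi (charge_of_finite_measure p) q)
          * ((1 - l)^-1)%:E)%E @[l --> 1^'-] --> -oo%E].
Proof.
move=> cp uS pS; split.
- exact: marginal_uniqueness_ll_minimal uS pS.
- exact: marginal_uniqueness_extreme uS pS.
move=> p' q phi cp' p'p _ pq p'q cphi phi1 slopeNy Dp Dp'.
have p'S : p' (~` S) <> 0%E.
  by move=> p'S; apply: p'p; exact: coupling_concentrated_eq uS pS _ cp' p'S.
have q0 := density_vanishing_set_neq0 (measurableC uS.1) pq p'q pS p'S.
pose F := density (charge_of_finite_measure p) q.
pose G := density (charge_of_finite_measure p') q.
have F0 : forall x, 0 <= F x by exact: density_ge0.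
have G0 : forall x, 0 <= G x by exact: density_ge0.
have iF : q.-integrable setT (EFin \o F) by exact: integrable_density.
have iG : q.-integrable setT (EFin \o G) by exact: integrable_density.
(* The divergence of the mixture is the integral of the mixed densities only
   for [0 <= l <= 1], hence the detour through eventual equality. *)
have := divergence_slope_cvgNy cphi phi1 F0 G0 iF iG Dp Dp' q0 slopeNy.
apply: cvg_trans; apply: near_eq_cvg; near=> l.
have l01 : 0 <= l <= 1.
  apply/andP; split; apply: ltW; near: l; first exact: nbhs_left_gt.
  exact: nbhs_left_lt.
congr ((_ - _) * _)%E; apply: ae_eq_integral => //.
- apply/measurable_EFinP; apply: measurable_convex_comp => //.
    apply: measurable_funD; apply: measurable_funM => //.
      exact: measurable_density.
    exact: measurable_density.
  move: l01 => /andP[? ?] x.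
  by rewrite addr_ge0// mulr_ge0// subr_ge0.
- apply/measurable_EFinP; apply: measurable_convex_comp => //.
    apply: measurable_density; apply: dominates_cadd; exact: dominates_cscalel.
  by move=> x; exact: density_ge0.
- by apply: filterS (ae_density_mixture l01 pq p'q) => x /(_ I) e _; rewrite -e.
Unshelve. all: by end_near.
Qed.
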